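(* Let $G$ be a connected graph on $n$ vertices whose edge weights are $s\times s$ positive definite matrices, and let $L$ be its Laplacian matrix. Let $X=(L+\frac{1}{n}J\otimes I_s)^{-1}$ (this matrix is invertible). Then the Moore--Penrose inverse of $L$ is $L^\dagger=X-\frac{1}{n}J\otimes I_s$.
   Context: $G$ is a simple connected graph with vertex set $\{1,\dots,n\}$; each edge $\{i,j\}$ carries a weight $W_{i,j}=W_{j,i}$, a real $s\times s$ positive definite matrix; $j\sim i$ means $i$ and $j$ are adjacent. The Laplacian $L$ is the $ns\times ns$ block matrix with $s\times s$ blocks indexed by vertices, whose $(i,i)$ block is $\sum_{j\sim i}W_{i,j}^{-1}$, whose $(i,j)$ block for $i\neq j$ is $-W_{i,j}^{-1}$ if $i\sim j$ and the zero matrix otherwise. $J$ is the $n\times n$ all-ones matrix, $I_s$ the $s\times s$ identity, $\otimes$ the Kronecker product. The Moore--Penrose inverse $A^\dagger$ of $A$ is the unique $G$ with $AGA=A$, $GAG=G$, $(AG)'=AG$, $(GA)'=GA$. *)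

(* Defs.v *)
From mathcomp Require Import all_boot all_order all_algebra.
From mathcomp Require Import mxtens.

Set Implicit Arguments.
Unset Strict Implicit.
Unset Printing Implicit Defensive.

Import Order.TTheory GRing.Theory Num.Theory.
Local Open Scope ring_scope.

Definition connected_graph (T : finType) (e : rel T) : Prop :=
  forall i j : T, connect e i j.

(* Positive definite matrices are symmetric by convention. *)
Definition posdefmx (R : realFieldType) (s : nat) (A : 'M[R]_s) : Prop :=
  A^T = A /\ forall x : 'cV[R]_s, x != 0 -> 0 < (x^T *m A *m x) 0 0.

Definition laplacian_block (R : fieldType) (n s : nat) (e : rel 'I_n)
    (W : 'I_n -> 'I_n -> 'M[R]_s) (i j : 'I_n) : 'M[R]_s :=
  if i == j then \sum_(k | e i k) invmx (W i k)
  else if e i j then - invmx (W i j) else 0.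

(* Row p of an (n * s)-matrix is row (mxtens_unindex p).2 of the block row
   (mxtens_unindex p).1; this is the indexing used by the Kronecker product
   [tensmx]. *)
Definition laplacian (R : fieldType) (n s : nat) (e : rel 'I_n)
    (W : 'I_n -> 'I_n -> 'M[R]_s) : 'M[R]_(n * s) :=
  \matrix_(p, q)
    laplacian_block e W (mxtens_unindex p).1 (mxtens_unindex q).1
      (mxtens_unindex p).2 (mxtens_unindex q).2.

Definition penrose (R : pzRingType) (m n : nat)
    (A : 'M[R]_(m, n)) (G : 'M[R]_(n, m)) : Prop :=
  [/\ A *m G *m A = A,
      G *m A *m G = G,
      (A *m G)^T = A *m G
    & (G *m A)^T = G *m A].

Definition is_moore_penrose_inverse (R : pzRingType) (m n : nat)
    (A : 'M[R]_(m, n)) (G : 'M[R]_(n, m)) : Prop :=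
  unique (penrose A) G.

(* Main.v *)
(** L annihilates the vectors that are constant on vertices; conversely, by
    positive definiteness of the weights and connectedness, only these, so
    that ker L is the range of the orthogonal projector P = (1/n) J (x) I_s.
    Hence L + P is injective, LP = PL = 0 gives XP = PX = P, and
    L(X - P) = (X - P)L = 1 - P, from which the Penrose equations follow. *)
Require Import Defs.
From mathcomp Require Import all_boot all_order all_algebra.
From mathcomp Require Import reals mxtens.

Set Implicit Arguments.
Unset Strict Implicit.
Unset Printing Implicit Defensive.

Import Order.TTheory GRing.Theory Num.Theory.
Local Open Scope ring_scope.

(** By symmetry of the products, AG = (AH)(AG) = ((AG)(AH))^T = (AH)^T = AH, and likewise GA = HA;
    then G = GAG = GAH = HAH = H. *)
Lemma penrose_uniq (R : comPzRingType) (m n : nat) (A : 'M[R]_(m, n))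
    (G H : 'M[R]_(n, m)) :
  penrose A G -> penrose A H -> G = H.
Proof.
move=> [AGA GAG AGs GAs] [AHA HAH AHs HAs].
have eqAG : A *m G = A *m H.
  by rewrite -{1}AHA -[_ *m G]mulmxA -AHs -AGs -trmx_mul mulmxA AGA AHs.
have eqGA : G *m A = H *m A.
  by rewrite -{1}AHA !mulmxA -[_ *m H *m A]mulmxA -HAs -GAs -trmx_mul
     -mulmxA [A *m _]mulmxA AGA HAs.
by rewrite -GAG -mulmxA eqAG mulmxA eqGA HAH.
Qed.

Lemma unitmx_ker0 (F : fieldType) (n : nat) (A : 'M[F]_n) :
  (forall x : 'cV[F]_n, A *m x = 0 -> x = 0) -> A \in unitmx.
Proof.
(* [kermx] is the left kernel, so the hypothesis on columns is used through the transpose. *)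
move=> kerA; rewrite -unitmx_tr -row_free_unit -kermx_eq0.
apply/rowV0P => v /sub_kermxP vA0.
by apply: trmx_inj; rewrite trmx0; apply: kerA;
   rewrite -[A]trmxK -trmx_mul vA0 trmx0.
Qed.

Lemma posdefmx_unit (R : realFieldType) (s : nat) (A : 'M[R]_s) :
  posdefmx A -> A \in unitmx.
Proof.
move=> [_ Apos]; apply: unitmx_ker0 => x Ax0; apply/eqP/negP => /negP /Apos.
by rewrite -mulmxA Ax0 mulmx0 mxE ltxx.
Qed.

(** The substitution y = A^-1 x turns the quadratic form of A^-1 at x into that of A at y. *)
Lemma posdefmx_inv (R : realFieldType) (s : nat) (A : 'M[R]_s) :
  posdefmx A -> posdefmx (invmx A).
Proof.
move=> Apd; have uA := posdefmx_unit Apd; case: Apd => Asym Apos.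
have iAs : (invmx A)^T = invmx A by rewrite trmx_inv Asym.
split=> // x xn0.
have : invmx A *m x != 0.
  by apply: contraNneq xn0 => y0; rewrite -[x](mulKVmx uA) y0 mulmx0.
by move/Apos; rewrite trmx_mul iAs -!mulmxA mulKVmx // !mulmxA.
Qed.

(** The value of x at vertex i, in the indexing shared by [laplacian] and [*t], so that both act
    blockwise. *)
Definition blk (R : Type) (n s : nat) (x : 'cV[R]_(n * s)) (i : 'I_n) :
    'cV[R]_s :=
  \col_k x (mxtens_index (i, k)) 0.

Lemma blk_inj (R : Type) (n s : nat) (x y : 'cV[R]_(n * s)) :
  blk x =1 blk y -> x = y.
Proof.
move=> exy; apply/colP => p; case: (mxtens_indexP p) => i k.
by have /colP/(_ k) := exy i; rewrite !mxE.
Qed.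

Lemma blk_mulmx (R : pzRingType) (n s : nat) (A : 'M[R]_(n * s))
    (x : 'cV[R]_(n * s)) (i : 'I_n) :
  blk (A *m x) i =
  \sum_j (\matrix_(k, l) A (mxtens_index (i, k)) (mxtens_index (j, l)))
         *m blk x j.
Proof.
apply/colP => k; rewrite !mxE summxE.
under [RHS]eq_bigr => j _ do rewrite mxE.
rewrite pair_big (reindex (@mxtens_index n s)) /=; last first.
  by exists (@mxtens_unindex n s) => p _;
     rewrite (mxtens_indexK, mxtens_unindexK).
by apply: eq_bigr => -[j l] _; rewrite !mxE.
Qed.

(** The diagonal block is a sum over the neighbours of i, so each of its terms pairs with one
    off-diagonal block; irreflexivity keeps j = i out of the sum over neighbours. *)
Lemma blk_laplacian (R : fieldType) (n s : nat) (e : rel 'I_n)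
    (W : 'I_n -> 'I_n -> 'M[R]_s) (x : 'cV[R]_(n * s)) (i : 'I_n) :
  irreflexive e ->
  blk (laplacian e W *m x) i =
  \sum_(j | e i j) invmx (W i j) *m (blk x i - blk x j).
Proof.
move=> e_irr; rewrite blk_mulmx.
transitivity (\sum_j laplacian_block e W i j *m blk x j).
  apply: eq_bigr => j _; congr (_ *m _); apply/matrixP => k l.
  by rewrite !mxE !mxtens_indexK.
rewrite (bigD1 i) //= /laplacian_block eqxx mulmx_suml.
under [RHS]eq_bigr do rewrite mulmxBr.
rewrite sumrB; congr (_ + _); rewrite -sumrN.
rewrite big_mkcond [RHS]big_mkcond; apply: eq_bigr => j _.
rewrite eq_sym; case: eqVneq => [<-|_]; first by rewrite e_irr.
by case: ifP => _; rewrite ?mulNmx ?mul0mx.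
Qed.

Lemma laplacian_sym (R : realFieldType) (n s : nat) (e : rel 'I_n)
    (W : 'I_n -> 'I_n -> 'M[R]_s) :
  symmetric e -> (forall i j, e i j -> W i j = W j i) ->
  (forall i j, e i j -> posdefmx (W i j)) ->
  (laplacian e W)^T = laplacian e W.
Proof.
move=> e_sym W_sym W_pd.
have iWs k l : e k l -> (invmx (W k l))^T = invmx (W k l).
  by move=> /W_pd/posdefmx_inv [].
have blockT i j : (laplacian_block e W i j)^T = laplacian_block e W j i.
  rewrite /laplacian_block eq_sym; case: eqVneq => [->|_].
    by rewrite raddf_sum; apply: eq_bigr => k /iWs.
  rewrite e_sym; case: ifP => eji; last by rewrite trmx0.
  by rewrite raddfN /= -W_sym // iWs.
by apply/matrixP => p q; rewrite !mxE -blockT mxE.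
Qed.

(* Summation by parts: each edge contributes its quadratic form twice. *)
Lemma laplacian_energy (R : fieldType) (n s : nat) (e : rel 'I_n)
    (W : 'I_n -> 'I_n -> 'M[R]_s) (x : 'cV[R]_(n * s)) :
  symmetric e -> irreflexive e -> (forall i j, e i j -> W i j = W j i) ->
  \sum_i \sum_(j | e i j)
    (blk x i - blk x j)^T *m invmx (W i j) *m (blk x i - blk x j) =
  (\sum_i (blk x i)^T *m blk (laplacian e W *m x) i) *+ 2.
Proof.
move=> e_sym e_irr W_sym.
under [in RHS]eq_bigr do rewrite blk_laplacian // mulmx_sumr.
rewrite mulr2n.
(* In the second copy the two ends of each edge are swapped; with d = x_i - x_j, the terms x_i^T
   W^-1 d and -x_j^T W^-1 d add up to d^T W^-1 d. *)
rewrite [X in _ + X](exchange_big_dep xpredT) //= -big_split /=.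
apply: eq_bigr => i _; under [X in _ + X]eq_bigl do rewrite e_sym.
rewrite -big_split; apply: eq_bigr => j eij /=.
rewrite -(W_sym _ _ eij) -[blk x j - _]opprB mulmxN mulmxN !mulmxA -!mulmxBl.
by rewrite -[(blk x i)^T - _]linearB.
Qed.

(** The energy of x vanishes, hence so does each nonnegative edge term; the blocks then agree across
    every edge, and along a path between any two vertices. *)
Lemma laplacian_ker (R : realFieldType) (n s : nat) (e : rel 'I_n)
    (W : 'I_n -> 'I_n -> 'M[R]_s) (x : 'cV[R]_(n * s)) :
  symmetric e -> irreflexive e -> connected_graph e ->
  (forall i j, e i j -> W i j = W j i) ->
  (forall i j, e i j -> posdefmx (W i j)) ->
  laplacian e W *m x = 0 -> forall i j, blk x i = blk x j.
Proof.
move=> e_sym e_irr e_conn W_sym W_pd Lx0.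
pose q i j : R :=
  ((blk x i - blk x j)^T *m invmx (W i j) *m (blk x i - blk x j)) 0 0.
have q_ge0 i j : e i j -> 0 <= q i j.
  move=> eij; rewrite /q; have [->|dn0] := eqVneq (blk x i - blk x j) 0.
    by rewrite mulmx0 mxE.
  by apply/ltW; have [_] := posdefmx_inv (W_pd _ _ eij); apply.
have sum_q : \sum_i \sum_(j | e i j) q i j = 0.
  have := laplacian_energy x e_sym e_irr W_sym.
  rewrite Lx0 [X in X *+ 2]big1 => [|i _]; last first.
    by rewrite (_ : blk 0 i = 0) ?mulmx0 //; apply/colP => k; rewrite !mxE.
  move/(congr1 (fun M : 'M_1 => M 0 0)); rewrite mul0rn [RHS]mxE => E.
  by rewrite -[RHS]E summxE; apply: eq_bigr => i _; rewrite summxE.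
have q0 i j : e i j -> q i j = 0.
  move=> eij.
  (* A vanishing sum of nonnegative terms has zero terms: first for the sum over i, then for the one
     over j. *)
  have /(psumr_eq0P _)/(_ i isT) := sum_q.
  move=> /(_ _)/(psumr_eq0P _) -> //; first by move=> k; apply: q_ge0.
  by move=> k _; apply: sumr_ge0 => l; apply: q_ge0.
have edge_eq i j : e i j -> blk x i = blk x j.
  move=> eij; apply/eqP; rewrite -subr_eq0; apply/negP => /negP dn0.
  have [_ /(_ _ dn0)] := posdefmx_inv (W_pd _ _ eij).
  by rewrite -/(q i j) q0 // ltxx.
move=> i j; have /connectP [p] := e_conn i j.
elim: p i => [|k p IHp] i /=; first by move=> _ ->.
by move=> /andP [/edge_eq -> /IHp].
Qed.

Definition avgmx (R : fieldType) (n s : nat) : 'M[R]_(n * s) :=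
  (n%:R^-1 *: const_mx 1) *t (1%:M : 'M[R]_s).

Lemma blk_avgmx (R : fieldType) (n s : nat) (x : 'cV[R]_(n * s)) (i : 'I_n) :
  blk (avgmx R n s *m x) i = n%:R^-1 *: \sum_j blk x j.
Proof.
rewrite blk_mulmx scaler_sumr; apply: eq_bigr => j _.
rewrite -mul_scalar_mx; congr (_ *m _); apply/matrixP => k l.
by rewrite mxE tensmxE !mxE mulr1 mulr_natr.
Qed.

Lemma avgmx_sym (R : fieldType) (n s : nat) : (avgmx R n s)^T = avgmx R n s.
Proof. by rewrite trmx_tens linearZ /= trmx_const trmx1. Qed.

Lemma avgmx_const (R : numFieldType) (n s : nat) (x : 'cV[R]_(n * s)) :
  (forall i j, blk x i = blk x j) -> avgmx R n s *m x = x.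
Proof.
move=> xc; apply: blk_inj => i; rewrite blk_avgmx.
rewrite (eq_bigr (fun=> blk x i)) // sumr_const card_ord -scaler_nat scalerA.
(* The vertex i itself witnesses n > 0. *)
by rewrite mulVf ?scale1r // pnatr_eq0 -lt0n (leq_ltn_trans _ (ltn_ord i)).
Qed.

Lemma mulmx_cV_inj (R : pzRingType) (m n : nat) (A B : 'M[R]_(m, n)) :
  (forall x : 'cV[R]_n, A *m x = B *m x) -> A = B.
Proof.
move=> eAB; apply/matrixP => i j.
by have /colP/(_ i) := eAB (delta_mx j 0); rewrite -!colE !mxE.
Qed.

(** All blocks of Px equal the same average, so Px is fixed by P. *)
Lemma avgmx_idem (R : numFieldType) (n s : nat) :
  avgmx R n s *m avgmx R n s = avgmx R n s.
Proof.
apply: mulmx_cV_inj => x; rewrite -mulmxA avgmx_const // => i j.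
by rewrite !blk_avgmx.
Qed.

Lemma laplacian_avgmx (R : fieldType) (n s : nat) (e : rel 'I_n)
    (W : 'I_n -> 'I_n -> 'M[R]_s) :
  irreflexive e -> laplacian e W *m avgmx R n s = 0.
Proof.
move=> e_irr; apply: mulmx_cV_inj => x; rewrite -mulmxA mul0mx.
apply: blk_inj => i; rewrite blk_laplacian // big1 => [|j _].
  by apply/colP => k; rewrite !mxE.
by rewrite !blk_avgmx subrr mulmx0.
Qed.

(** Cancelling L + P in (L + P)P = P = P(L + P) gives XP = P = PX; writing L as (L + P) - P then
    yields both products with X - P. *)
Lemma penrose_sub_proj (R : comUnitRingType) (n : nat) (L P : 'M[R]_n) :
  P^T = P -> P *m P = P -> L *m P = 0 -> P *m L = 0 -> L + P \in unitmx ->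
  penrose L (invmx (L + P) - P).
Proof.
move=> Ps PP LP PL uLP; set X := invmx _.
have XP : X *m P = P by rewrite -[RHS](mulKmx uLP) mulmxDl LP PP add0r.
have PX : P *m X = P by rewrite -[RHS](mulmxK uLP) mulmxDr PL PP add0r.
have LG : L *m (X - P) = 1%:M - P.
  by rewrite mulmxBr LP subr0 -[L in LHS](addrK P) mulmxBl mulmxV // PX.
have GL : (X - P) *m L = 1%:M - P.
  by rewrite mulmxBl PL subr0 -[L in LHS](addrK P) mulmxBr mulVmx // XP.
split; rewrite ?LG ?GL ?mulmxBl ?mul1mx ?PL ?subr0 //.
(* (1 - P)(X - P) = X - P because P(X - P) = P - P = 0. *)
- by rewrite mulmxBr PX PP subrr subr0.
- by rewrite linearB /= trmx1 Ps.
- by rewrite linearB /= trmx1 Ps.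
Qed.

Theorem theorem3p2 (R : realType) (n s : nat) (n_gt0 : (0 < n)%N)
    (s_gt0 : (0 < s)%N) (e : rel 'I_n) (e_sym : symmetric e)
    (e_irr : irreflexive e) (e_conn : connected_graph e)
    (W : 'I_n -> 'I_n -> 'M[R]_s)
    (W_sym : forall i j : 'I_n, e i j -> W i j = W j i)
    (W_pd : forall i j : 'I_n, e i j -> posdefmx (W i j)) :
  let L : 'M[R]_(n * s) := laplacian e W in
  let J : 'M[R]_n := const_mx 1 in
  let P : 'M[R]_(n * s) := ((n%:R^-1 *: J) *t (1%:M : 'M[R]_s)) in
  let X : 'M[R]_(n * s) := invmx (L + P) in
  L + P \in unitmx /\ is_moore_penrose_inverse L (X - P).
Proof.
move=> L J P X; rewrite /X.
have Ls : L^T = L by apply: laplacian_sym.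
have Ps : P^T = P by apply: avgmx_sym.
have PP : P *m P = P by apply: avgmx_idem.
have LP : L *m P = 0 by apply: laplacian_avgmx.
have PL : P *m L = 0 by rewrite -Ps -Ls -trmx_mul LP trmx0.
have uLP : L + P \in unitmx.
  apply: unitmx_ker0 => x LPx0.
  (* Applying P to (L + P)x = 0 removes Lx and leaves Px = 0, hence Lx = 0 as well; x is then
     constant on vertices, so x = Px = 0. *)
  have Px0 : P *m x = 0.
    by have := congr1 (mulmx P) LPx0; rewrite mulmx0 mulmxA mulmxDr PL add0r PP.
  have Lx0 : L *m x = 0 by move: LPx0; rewrite mulmxDl Px0 addr0.
  by rewrite -Px0; apply/esym/avgmx_const/(laplacian_ker _ _ _ _ _ Lx0).
have pen := penrose_sub_proj Ps PP LP PL uLP.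
by split=> //; split=> // G; apply: penrose_uniq.
Qed.
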